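(* Let $G$ be a finite simple connected graph with at least one edge. If $G$ induces a $k$-periodic Grover walk for some odd positive integer $k$, then $G$ is an odd cycle or an odd unicycle graph.
   Context: Graphs are finite and simple (no loops, no multiple edges). For a graph $G$ with $m=|E(G)|$ edges, let $D(G)$ be the set of symmetric arcs of $G$: each edge $\{u,v\}\in E(G)$ gives the two arcs $(u,v)$ and $(v,u)$, so $|D(G)|=2m$. For an arc $e=(u,v)$ write $o(e)=u$, $t(e)=v$, $e^{-1}=(v,u)$. The Grover transfer matrix of $G$ is the $2m\times 2m$ matrix $U=U(G)=(U_{e,f})_{e,f\in D(G)}$ with $$U_{e,f}=\begin{cases}2/\deg(t(f)) & \text{if } t(f)=o(e) \text{ and } f\neq e^{-1},\\ 2/\deg(t(f))-1 & \text{if } f=e^{-1},\\ 0 & \text{otherwise.}\end{cases}$$ For a positive integer $k$, $G$ is said to induce a $k$-periodic Grover walk if $U^k=I_{2m}$ and $U^j\neq I_{2m}$ for every integer $j$ with $1\le j<k$. An odd cycle is a cycle graph $C_l$ ($l\geq 3$ vertices) with $l$ odd. A connected graph is called unicycle if it has exactly one cycle and removing (the vertices of) that cycle leaves a non-empty forest; in particular cycle graphs themselves are not called unicycle. A unicycle graph is an odd unicycle if the length of its unique cycle is odd. *)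

(* Defs.v *)
From HB Require Import structures.
From mathcomp Require Import all_boot all_order all_algebra.

Set Implicit Arguments.
Unset Strict Implicit.
Unset Printing Implicit Defensive.

Import GRing.Theory Num.Theory.
Local Open Scope ring_scope.

(* A finite simple graph is a symmetric irreflexive relation on a finType. *)

Definition edges (T : finType) (e : rel T) : {set {set T}} :=
  [set [set p.1; p.2] | p : T * T & e p.1 p.2].

Definition degree (T : finType) (e : rel T) (x : T) : nat :=
  #|[set y | e x y]|.

Definition connected (T : finType) (e : rel T) : Prop :=
  forall x y : T, connect e x y.

Definition induced (T : finType) (e : rel T) (A : {set T}) :
    rel {x : T | x \in A} :=
  [rel x y | e (val x) (val y)].

Definition arc (T : finType) (e : rel T) : finType :=
  {p : T * T | e p.1 p.2}.

Definition origin (T : finType) (e : rel T) (a : arc e) : T := (val a).1.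

Definition terminus (T : finType) (e : rel T) (a : arc e) : T := (val a).2.

(* Comparing endpoints avoids building the reversed arc, which would need the
   symmetry of e as an argument. *)
Definition is_inverse (T : finType) (e : rel T) (a b : arc e) : bool :=
  (origin a == terminus b) && (terminus a == origin b).

Definition grover_entry (R : numFieldType) (T : finType) (e : rel T)
    (a b : arc e) : R :=
  if (terminus b == origin a) && ~~ is_inverse b a then
    2 / (degree e (terminus b))%:R
  else if is_inverse b a then
    2 / (degree e (terminus b))%:R - 1
  else 0.

(* Rows and columns are indexed by arcs through enum_val. *)
Definition grover (R : numFieldType) (T : finType) (e : rel T) :
    'M[R]_#|{: arc e}| :=
  \matrix_(i, j) grover_entry R (enum_val i) (enum_val j).

Definition periodic_grover_walk (R : numFieldType) (T : finType) (e : rel T)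
    (k : nat) : Prop :=
  [/\ (0 < k)%N,
      grover R e ^+ k = 1%:M &
      forall j : nat, (1 <= j < k)%N -> grover R e ^+ j <> 1%:M].

Definition cycle_graph (l : nat) : rel 'I_l :=
  [rel i j | (j == ordS i) || (i == ordS j)].

Definition isomorphic (T T' : finType) (e : rel T) (e' : rel T') : Prop :=
  exists2 f : T -> T', bijective f & forall x y : T, e' (f x) (f y) = e x y.

Definition odd_cycle (T : finType) (e : rel T) : Prop :=
  exists l : nat, [/\ (3 <= l)%N, odd l & isomorphic e (@cycle_graph l)].

(* A cycle of the graph, given by the list of its successive vertices from
   some starting point, in one of the two directions. *)
Definition graph_cycle (T : finType) (e : rel T) (c : seq T) : bool :=
  [&& (3 <= size c)%N, uniq c & cycle e c].

(* Lists differing by rotation or reversal describe the same cycle; the edge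
   set identifies the cycle as a subgraph. *)
Definition cycle_edges (T : finType) (c : seq T) : {set {set T}} :=
  [set [set x; next c x] | x in c].

Definition forest (T : finType) (e : rel T) : Prop :=
  forall c : seq T, ~~ graph_cycle e c.

Definition unicycle_with (T : finType) (e : rel T) (c : seq T) : Prop :=
  [/\ connected e,
      graph_cycle e c,
      forall c' : seq T, graph_cycle e c' -> cycle_edges c' = cycle_edges c,
      ~: [set x in c] != set0 &
      forest (@induced T e (~: [set x in c]))].

Definition odd_unicycle (T : finType) (e : rel T) : Prop :=
  exists2 c : seq T, unicycle_with e c & odd (size c).

(* Main.v *)
Require Import Defs.
From HB Require Import structures.
From mathcomp Require Import all_boot all_order all_algebra.
From mathcomp Require Import zify.

(** If k is odd and U ^ k = 1, then -1 is not an eigenvalue of U.  Two kinds of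
    arc functions would be eigenvectors for -1: the sign of a proper
    2-colouring, evaluated at the origin of the arc, and every element of the
    kernel of the unsigned incidence matrix, read as a symmetric function on
    arcs.  Hence G is not bipartite, so it has an odd cycle, and |E| <= |V|.
    Since a connected graph has |E| >= |V| - 1, at most one edge of G can be
    deleted without disconnecting it; so every edge outside a given cycle is a
    bridge, and the cycle is unique. *)

Set Implicit Arguments.
Unset Strict Implicit.
Unset Printing Implicit Defensive.

Import GRing.Theory Num.Theory.

Section Graph.

Variable T : finType.
Implicit Types (e : rel T) (c : seq T) (E : {set T}).

(** * Edges, edge deletion and connectivity *)

Lemma set2_inj (a b c d : T) :
  [set a; b] = [set c; d] -> (a = c /\ b = d) \/ (a = d /\ b = c).
Proof.
move=> eqE.
have : a \in [set c; d] by rewrite -eqE set21.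
have : b \in [set c; d] by rewrite -eqE set22.
have : c \in [set a; b] by rewrite eqE set21.
have : d \in [set a; b] by rewrite eqE set22.
rewrite !inE => + + /orP[]/eqP eb /orP[]/eqP ea; rewrite eb ea; auto.
  by move=> /orP[]/eqP->; auto.
by move=> _ /orP[]/eqP->; auto.
Qed.

Lemma mem_edges e x y : e x y -> [set x; y] \in edges e.
Proof. by move=> exy; apply/imsetP; exists (x, y); rewrite ?inE. Qed.

Lemma edgesP e E :
  reflect (exists x y, e x y /\ E = [set x; y]) (E \in edges e).
Proof.
apply: (iffP imsetP) => [[[x y]] | [x [y [exy ->]]]].
  by rewrite inE /= => exy ->; exists x, y.
by exists (x, y); rewrite ?inE.
Qed.

Definition del_edge e E : rel T := [rel x y | e x y && ([set x; y] != E)].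

Lemma edges_del e E : edges (del_edge e E) = edges e :\ E.
Proof.
apply/setP=> F; rewrite !inE; apply/edgesP/andP.
  by move=> [x [y [/andP[exy nE] ->]]]; rewrite nE mem_edges.
move=> [nE /edgesP[x [y [exy eF]]]]; exists x, y; split=> //.
by rewrite /del_edge /= exy -eF.
Qed.

Lemma del_edge_sym e E : symmetric e -> symmetric (del_edge e E).
Proof. by move=> es x y; rewrite /del_edge /= es setUC. Qed.

(** A path that uses the deleted edge is rerouted along the connection from [u] to [v] that avoids
    it, reversed if necessary. *)
Lemma connected_del_edge e u v : symmetric e -> connected e ->
  connect (del_edge e [set u; v]) u v -> connected (del_edge e [set u; v]).
Proof.
move=> es ec cuv x y; apply: connect_sub (ec x y) => {}x {}y exy.
have [/set2_inj[[-> ->]|[-> ->]]|nE] := eqVneq [set x; y] [set u; v] => //.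
  by rewrite (sym_connect_sym (del_edge_sym _ es)).
by apply: connect1; rewrite /del_edge /= exy nE.
Qed.

(* A connected part of the graph with n vertices and n - 1 edges can be
   extended by any edge that leaves it. *)
Lemma connected_card e : connected e -> #|T| <= #|edges e|.+1.
Proof.
move=> ec.
suff grow n : n < #|T| -> exists (A : {set T}) (F : {set {set T}}),
    [/\ #|A| = n.+1, F \subset edges e, {in F, forall E, E \subset A}
       & #|F| = n].
  case: (posnP #|T|) => [-> //|T_gt0].
  have [|A [F [_ sF _ cF]]] := grow #|T|.-1; first by rewrite prednK.
  by rewrite -(prednK T_gt0) ltnS -cF subset_leq_card.
elim: n => [|n IHn] ltnT.
  have [x _] := card_gt0P ltnT.
  exists [set x], set0; split; rewrite ?cards1 ?cards0 ?sub0set // => E.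
  by rewrite inE.
have [A [F [cA sF FA cF]]] := IHn (ltnW ltnT).
have [/existsP[u /existsP[v /and3P[uA vA euv]]]|noE] :=
    boolP [exists u, exists v, [&& u \in A, v \notin A & e u v]].
  exists (v |: A), ([set u; v] |: F); split.
  - by rewrite cardsU1 vA cA.
  - by rewrite subUset sub1set mem_edges.
  - move=> E; rewrite !inE => /orP[/eqP->|/FA sEA].
      by rewrite subUset !sub1set !inE eqxx uA orbT.
    by rewrite (subset_trans sEA) ?subsetUr.
  rewrite cardsU1 cF; case: (boolP (_ \in F)) => // /FA.
  by rewrite subUset !sub1set (negPf vA) andbF.
(* When no edge leaves [A], connectivity makes [A] everything, against [n.+1 < #|T|]. *)
have AT : A = setT.
  have [x xA] : exists x, x \in A by apply/card_gt0P; rewrite cA.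
  apply/setP=> y; rewrite inE.
  have /connectP[p ep ->] := ec x y.
  elim: p x xA ep => //= z p IHp x xA /andP[exz ep]; apply: IHp ep.
  apply: contraR noE => zA; apply/existsP; exists x; apply/existsP; exists z.
  by rewrite xA zA.
by move: ltnT; rewrite -cA AT cardsT ltnn.
Qed.

(** * Cycles, bridges and uniqueness of the cycle *)

(** The rest of the cycle leads from [next c x] round to [x]. It avoids the deleted edge because the
    vertices are distinct and there are at least three. *)
Lemma connect_del_cycle_edge e c x : graph_cycle e c -> x \in c ->
  symmetric e ->
  connect (del_edge e [set x; next c x]) x (next c x).
Proof.
move=> /and3P[c3 cu cc] xc es.
rewrite (sym_connect_sym (del_edge_sym _ es)).
have [i p def_c] := rot_to xc.
rewrite -(next_rot i cu); move: c3 cu cc.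
rewrite -(size_rot i) -(rot_uniq i) -(rot_cycle i) def_c.
case: p {def_c} => [|y [|z q]] //= _; rewrite eqxx.
rewrite !inE !negb_or -!andbA => /and5P[nxy nxz xq nyz /and3P[yq _ _]].
rewrite rcons_path => /and4P[_ eyz ep elx].
apply/connectP; exists (z :: rcons q x); last by rewrite /= last_rcons.
rewrite /= rcons_path {1}/del_edge /= eyz /=; apply/and3P; split.
- apply: contraNneq nxz => eqE.
  by have := set21 x y; rewrite -eqE !inE (negPf nxy).
- apply: (@sub_in_path _ [pred t | t != x] e) ep.
    move=> a b; rewrite /del_edge !inE /= => ax bx -> /=; apply: contraNneq ax => eqE.
    by have := set21 x y; rewrite -eqE !inE 2![x == _]eq_sym (negPf bx) orbF.
  rewrite /= [z == x]eq_sym nxz; apply/allP=> t tq /=.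
  by apply: contraNneq xq => <-.
rewrite /del_edge /= elx /=; apply/negP=> /eqP eqE.
have : y \in [set last z q; x] by rewrite eqE set22.
rewrite !inE [y == x]eq_sym (negPf nxy) orbF => /eqP yl.
by have := mem_last z q; rewrite -yl inE (negPf nyz) (negPf yq).
Qed.

Lemma graph_cycle_del_edge e c E :
  graph_cycle e c -> E \notin cycle_edges c -> graph_cycle (del_edge e E) c.
Proof.
move=> /and3P[c3 cu cc] Ec; rewrite /graph_cycle c3 cu /=.
apply: cycle_from_next cu _ => x xc; apply/andP; split; first exact: next_cycle.
by apply: contraNneq Ec => <-; apply/imsetP; exists x.
Qed.

(* Otherwise this edge and an edge of c could both be deleted without
   disconnecting the graph. *)
Lemma cycle_edges_bridge e c u v :
    symmetric e -> connected e -> #|edges e| <= #|T| -> graph_cycle e c ->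
    e u v -> connect (del_edge e [set u; v]) u v ->
  [set u; v] \in cycle_edges c.
Proof.
move=> es ec card_e c_cyc euv cuv; apply/negPn/negP=> uvc.
have ec' := connected_del_edge es ec cuv.
have es' := @del_edge_sym e [set u; v] es.
have cc' := graph_cycle_del_edge c_cyc uvc.
have [x xc] : exists x, x \in c.
  by case/and3P: c_cyc; case: (c) => // x s _ _ _; exists x; rewrite mem_head.
have := connected_card (connected_del_edge es' ec'
          (connect_del_cycle_edge cc' xc es')).
move: card_e; rewrite !edges_del (cardsD1 [set u; v]) mem_edges //.
rewrite (cardsD1 [set x; next c x] (_ :\ _)) -edges_del mem_edges.
  by rewrite !add1n => /leq_trans h /h; rewrite ltnn.
by apply: next_cycle xc; case/and3P: cc'.
Qed.

(** An edge of one cycle is bypassed by the rest of that cycle, hence is no bridge and must lie on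
    the other cycle. *)
Lemma cycle_edges_uniq e c c' :
    symmetric e -> connected e -> #|edges e| <= #|T| ->
  graph_cycle e c -> graph_cycle e c' -> cycle_edges c' = cycle_edges c.
Proof.
move=> es ec card_e.
suff sub c1 c2 : graph_cycle e c1 -> graph_cycle e c2 ->
    cycle_edges c1 \subset cycle_edges c2.
  by move=> cc cc'; apply/eqP; rewrite eqEsubset !sub.
move=> cc1 cc2; apply/subsetP=> _ /imsetP[x xc ->].
apply: cycle_edges_bridge => //; last exact: connect_del_cycle_edge.
by apply: next_cycle xc; case/and3P: cc1.
Qed.

(** * Odd cycles and 2-colourings *)

(** A repeated vertex splits the closed walk into two shorter ones whose lengths add up to an odd
    number, so one of them is odd and induction applies. *)
Lemma odd_closed_walk e c : irreflexive e -> cycle e c -> odd (size c) ->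
  exists2 c', graph_cycle e c' & odd (size c').
Proof.
move=> ei; have [n] := ubnP (size c); elim: n c => // n IHn c.
rewrite ltnS => le_n cc co; have [cu|] := boolP (uniq c).
  exists c => //; rewrite /graph_cycle cu cc.
  by case: c cc co {le_n cu} => [|x [|y [|z c]]] //=; rewrite ei.
move/(uniqPn _) => /=.
case: c cc co le_n => // x0 c cc co le_n /(_ x0)[i [j [lt_ij lt_j eq_ij]]].
set s := x0 :: c in cc co le_n lt_j eq_ij.
pose x := nth x0 s i.
have def_s : s = take i s ++ (x :: take (j - i.+1) (drop i.+1 s))
                 ++ x :: drop j.+1 s.
  rewrite -[LHS](cat_take_drop i) (drop_nth x0 (ltn_trans lt_ij lt_j)) -/x.
  rewrite cat_cons -[X in _ :: X](cat_take_drop (j - i.+1)) drop_drop subnK //.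
  by rewrite (drop_nth x0 lt_j) -eq_ij.
move: (take i s) (take (j - i.+1) (drop i.+1 s)) (drop j.+1 s) def_s
  => p1 p2 p3 def_s.
(* The cuts are at the two occurrences of [x]; the second walk wraps around the end of the list. *)
have : cycle e (x :: p2) && cycle e (x :: p3 ++ p1).
  move: cc; rewrite def_s -(rot_cycle (size p1)) rot_size_cat /=.
  by rewrite -catA /= rcons_cat cat_path /= rcons_path andbA -!rcons_path.
move: co le_n; rewrite def_s !size_cat /= => co le_n /andP[c1 c2].
have [o1|o1] := boolP (odd (size (x :: p2))).
  by apply: (IHn (x :: p2)) => //=; lia.
move: o1 => /= o1; apply: (IHn (x :: p3 ++ p1)) => //=; rewrite size_cat; lia.
Qed.

(** Colour each vertex by the parity of a chosen walk from a root [r]. Either this colouring is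
    proper, or an edge with equally coloured ends closes up two walks to an odd closed walk. *)
Lemma bipartite_or_odd_cycle e :
    symmetric e -> irreflexive e -> connected e ->
  (exists s : T -> bool, forall x y, e x y -> s x != s y) \/
  (exists2 c, graph_cycle e c & odd (size c)).
Proof.
move=> es ei ec; have [r _|T0] := pickP (fun _ : T => true); last first.
  by left; exists (fun _ => true) => x; have := T0 x.
have walk x : exists p, path e r p && (last r p == x).
  by have /connectP[p ep ->] := ec r x; exists p; rewrite ep eqxx.
pose w x := xchoose (walk x).
have wP x : path e r (w x) /\ last r (w x) = x.
  by have /andP[-> /eqP] := xchooseP (walk x).
pose s x := odd (size (w x)).
have [/existsP[x /existsP[y /andP[exy sxy]]]|noE] :=
    boolP [exists x, exists y, e x y && (s x == s y)]; last first.
  left; exists s => x y exy; apply: contraNN noE => sxy.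
  by apply/existsP; exists x; apply/existsP; exists y; rewrite exy.
right; have [[px lx] [py ly]] := (wP x, wP y).
(* From [r] to [x], across to [y], then back along [w y]. The list omits the initial [r] and ends
   with it, so it counts each step once. *)
apply: (@odd_closed_walk e (w x ++ y :: rev (belast r (w y)))) => //; last first.
  move: sxy => /eqP; rewrite /s size_cat /= size_rev size_belast oddD /= => ->.
  by rewrite addbN addbb.
rewrite (cycle_path r) last_cat /=.
have -> : last y (rev (belast r (w y))) = r.
  by case: (w y) ly => //= a q _; rewrite rev_cons last_rcons.
rewrite cat_path px /= lx exy -{1}ly rev_path.
by rewrite (eq_path (e' := e)) // => a b; rewrite es.
Qed.

(** * Spanning cycles as cycle graphs *)

Lemma next_nth_ord (l : nat) (c : seq T) (x0 : T) (i : 'I_l) :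
  size c = l -> uniq c -> next c (nth x0 c i) = nth x0 c (ordS i).
Proof.
move=> sz cu; have ltic : i < size c by rewrite sz.
rewrite next_nth mem_nth // index_uniq //=.
case: c sz cu ltic => //= y c sz cu ltic.
have [lt_i|ge_i] := ltnP i (size c).
  rewrite modn_small; last by rewrite -[X in (_ < X)%N]sz ltnS.
  exact: set_nth_default.
(* At the last position [nth] falls back on its default, the head [y], which matches [ordS] wrapping
   to 0. *)
have -> : i = size c :> nat by apply/eqP; rewrite eqn_leq -ltnS ltic.
by rewrite sz modnn nth_default.
Qed.

(** The isomorphism is the position in [c], which turns [next c] into [ordS]. *)
Lemma spanning_cycle_isomorphic e c : symmetric e -> graph_cycle e c ->
    (forall x, x \in c) -> (forall x y, e x y -> [set x; y] \in cycle_edges c) ->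
  isomorphic e (@cycle_graph (size c)).
Proof.
move=> es /and3P[c3 cu cc] cT eE.
have idx x : index x c < size c by rewrite index_mem.
pose f x := Ordinal (idx x).
have x0 : T by case: (c) c3.
pose g (i : 'I_(size c)) := nth x0 c i.
have fK : cancel f g by move=> x; rewrite /g nth_index.
have gK : cancel g f by move=> i; apply: val_inj; rewrite /= index_uniq.
have next_f x : f (next c x) = ordS (f x).
  by rewrite -[x in LHS]fK next_nth_ord // gK.
exists f => [|x y]; first by exists g.
rewrite /cycle_graph /= -!next_f !(can_eq fK).
apply/orP/idP => [[/eqP->|/eqP->]|/eE/imsetP[z _ /set2_inj]].
- exact: next_cycle.
- by rewrite es; apply: next_cycle.
by case=> -[-> ->]; rewrite eqxx; auto.
Qed.

End Graph.

Local Open Scope ring_scope.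

(** * The eigenvalue -1 of the Grover matrix *)

Section Grover.

Variables (R : numFieldType) (T : finType) (e : rel T).
Hypothesis e_sym : symmetric e.

Lemma arc_inverse (a : Defs.arc e) : exists b : Defs.arc e, is_inverse b a.
Proof.
have eP : e (val a).2 (val a).1 by rewrite e_sym; exact: (valP a).
by exists (Sub ((val a).2, (val a).1) eP); rewrite /is_inverse !eqxx.
Qed.

Lemma is_inverse_inj (a b b' : Defs.arc e) :
  is_inverse b a -> is_inverse b' a = (b' == b).
Proof.
move=> /andP[/eqP ob /eqP tb]; apply/idP/eqP => [/andP[/eqP ob' /eqP tb']|->].
  apply: val_inj; rewrite [LHS]surjective_pairing [RHS]surjective_pairing.
  by congr pair; [exact: etrans ob' (esym ob) | exact: etrans tb' (esym tb)].
by rewrite /is_inverse ob tb !eqxx.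
Qed.

Lemma sum_arcs_into (F : T -> T -> R) (x : T) :
  \sum_(b : Defs.arc e | terminus b == x) F (origin b) (terminus b) =
  \sum_(y | e x y) F y x.
Proof.
pose P := [pred p : T * T | e p.1 p.2].
rewrite -(big_sub_cond P [pred p | p.2 == x] (fun p => F p.1 p.2)) /=.
rewrite (reindex_onto (fun y => (y, x)) fst) /=.
  by apply: eq_bigl => y; rewrite !inE /= !eqxx !andbT e_sym.
by move=> [y z] /= /andP[_ /eqP->].
Qed.

(** Row [a] of the matrix is 2/deg on all arcs ending at [origin a], minus the indicator of the
    inverse [b]. Thus the value at [a] is the scaled sum minus [f b], which the condition makes
    equal to [- f a]. *)
Lemma grover_eigenN1 (f : Defs.arc e -> R) :
    (forall a b, is_inverse b a ->
       2 / (degree e (origin a))%:R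
         * \sum_(b' | terminus b' == origin a) f b' = f b - f a) ->
  let v := \col_i f (enum_val i) in grover R e *m v = - v.
Proof.
move=> fP v; apply/matrixP=> i j; rewrite !mxE; set a := enum_val i.
have [b ba] := arc_inverse a.
under eq_bigr => k _ do rewrite !mxE.
rewrite -(big_enum_val (fun b => grover_entry R a b * f b)) /=.
transitivity (\sum_b' ((if terminus b' == origin a
    then 2 / (degree e (origin a))%:R * f b' else 0)
    - (if b' == b then f b' else 0))).
  apply: eq_bigr => b' _; rewrite /grover_entry -(is_inverse_inj _ ba).
  have [inv|ninv] := boolP (is_inverse b' a); last first.
    rewrite andbT subr0; case: eqP => [->|] //; by rewrite mul0r.
  rewrite andbF; move: inv => /andP[_ /eqP->]; rewrite eqxx.
  by rewrite mulrBl mul1r.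
rewrite big_split /= sumrN -!big_mkcond /= -mulr_sumr big_pred1_eq (fP a b) //.
by rewrite addrAC subrr add0r.
Qed.

(** Applying [U ^+ k] to [v] gives both [v] and [- v], and 2 is nonzero in [R]. *)
Lemma odd_period_eigenN1 (n : nat) (U : 'M[R]_n) (v : 'cV[R]_n) (k : nat) :
  odd k -> U ^+ k = 1%:M -> U *m v = - v -> v = 0.
Proof.
move=> k_odd Uk Uv.
have UXv j : U ^+ j *m v = (-1) ^+ j *: v.
  elim: j => [|j IHj]; first by rewrite expr0 scale1r mul1mx.
  by rewrite exprSr -mulmxA Uv mulmxN IHj exprSr mulrN1 scaleNr.
have := UXv k; rewrite Uk mul1mx -signr_odd k_odd expr1 scaleN1r => /eqP.
rewrite -subr_eq0 opprK -mulr2n -scaler_nat scaler_eq0 pnatr_eq0 /=.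
by move=> /eqP.
Qed.

Variable k : nat.
Hypotheses (k_odd : odd k) (Uk : grover R e ^+ k = 1%:M).

Lemma odd_period_trivial (f : Defs.arc e -> R) :
    (forall a b, is_inverse b a ->
       2 / (degree e (origin a))%:R
         * \sum_(b' | terminus b' == origin a) f b' = f b - f a) ->
  forall a, f a = 0.
Proof.
move=> fP a.
have /colP/(_ (enum_rank a)) := odd_period_eigenN1 k_odd Uk (grover_eigenN1 fP).
by rewrite !mxE enum_rankK.
Qed.

Lemma degree_sum (x : T) : (degree e x)%:R = \sum_(y | e x y) 1 :> R.
Proof.
by rewrite /degree -sum1dep_card natr_sum.
Qed.

Lemma odd_period_not_bipartite (s : T -> bool) :
  (forall x y, e x y -> s x != s y) -> edges e = set0.
Proof.
move=> sP; apply/eqP; apply: contraT => /set0Pn[_ /edgesP[x [y [exy _]]]].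
have [] := elimF eqP (signr_eq0 R (s x)).
apply: (@odd_period_trivial (fun a => (-1) ^+ s (origin a)) _
          (Sub (x, y) exy)) => a b /andP[/eqP ob _].
have sN u v : e u v -> (-1) ^+ s v = - (-1) ^+ s u :> R.
  by move/sP; case: (s u); case: (s v) => //= _; rewrite ?expr0 ?expr1 ?opprK.
have ea : e (origin a) (terminus a) := valP a.
(* Every arc into [origin a] starts at the opposite colour, so both sides are -2 times the sign of
   [origin a]. *)
rewrite (sum_arcs_into (fun z _ => (-1) ^+ s z)) ob (sN _ _ ea).
under eq_bigr => z /sN-> do rewrite -[(-1) ^+ _]mul1r -mulrN.
rewrite -mulr_suml -degree_sum mulrA divfK.
  by rewrite mulrN mulr_natl mulr2n opprD.
rewrite pnatr_eq0 -lt0n /degree; apply/card_gt0P.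
by exists (terminus a); rewrite inE.
Qed.

Lemma odd_period_card_edges : (#|edges e| <= #|T|)%N.
Proof.
rewrite leqNgt; apply/negP => lt_TE.
pose M : 'M[R]_(#|edges e|, #|T|) :=
  \matrix_(i, j) (enum_val j \in (enum_val i : {set T}))%:R.
(* With more edges than vertices the incidence matrix has more rows than columns, hence a nonzero
   left kernel vector: edge weights summing to 0 at every vertex. *)
have /rowV0Pn[v /sub_kermxP vM vn0] : kermx M != 0.
  by rewrite -mxrank_eq0 mxrank_ker subn_eq0 -ltnNge (leq_ltn_trans (rank_leq_col M)).
pose w (E : {set T}) := \sum_(i | enum_val i == E) v 0 i.
have w_val i : w (enum_val i) = v 0 i.
  rewrite /w (eq_bigl (pred1 i)) ?big_pred1_eq // => j.
  by rewrite /= (inj_eq enum_val_inj).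
have w_sum x : \sum_(y | e x y) w [set y; x] = 0.
  transitivity (\sum_(E in edges e | x \in E) w E).
    rewrite -(big_imset (h := fun y => [set y; x]) w (A := e x)) /=; last first.
      by move=> y z exy exz /set2_inj[[]//|[-> <-]//].
    apply: eq_bigl => E; apply/imsetP/andP.
      move=> [y exy ->]; rewrite set22; split=> //.
      by rewrite setUC mem_edges.
    move=> [/edgesP[u [z [euz ->]]]]; rewrite !inE => /orP[]/eqP->.
      by exists z; rewrite // setUC.
    by exists u; rewrite // -topredE /= e_sym.
  rewrite big_mkcondr big_enum_val /=.
  have /rowP/(_ (enum_rank x)) := vM; rewrite !mxE => vMx; rewrite -[RHS]vMx.
  apply: eq_bigr => i _; rewrite w_val !mxE enum_rankK.
  by case: ifP; rewrite ?mulr1 ?mulr0.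
case/negP: vn0; apply/eqP/rowP=> i; rewrite mxE -w_val.
have /edgesP[x [y [exy ->]]] := enum_valP i.
(* The vertex sums vanish and [w] agrees on an arc and its inverse, so both sides of the eigenvector
   condition are 0. *)
apply: (@odd_period_trivial (fun a => w [set origin a; terminus a]) _
          (Sub (x, y) exy)) => a b /andP[/eqP-> /eqP->].
rewrite (sum_arcs_into (fun y z => w [set y; z])) w_sum mulr0.
by rewrite [[set terminus a; _]]setUC subrr.
Qed.

End Grover.

Theorem theorem3p1 (R : numFieldType) (T : finType) (e : rel T)
    (e_sym : symmetric e) (e_irr : irreflexive e)
    (e_conn : connected e) (e_edge : edges e != set0)
    (k : nat) (k_odd : odd k) (k_per : periodic_grover_walk R e k) :
  odd_cycle e \/ odd_unicycle e.
Proof.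
have [_ Uk _] := k_per.
have card_e := odd_period_card_edges e_sym k_odd Uk.
have [[s /(odd_period_not_bipartite e_sym k_odd Uk) e0]|[c cc co]] :=
  bipartite_or_odd_cycle e_sym e_irr e_conn.
  by rewrite e0 eqxx in e_edge.
have c_uniq c' := @cycle_edges_uniq _ e c c' e_sym e_conn card_e cc.
(* A spanning [c] gives the odd cycle, a non-spanning one the odd unicycle. *)
have [cT|nspan] := eqVneq (~: [set x in c]) set0.
  have {}cT x : x \in c.
    by apply/negPn/negP => xc; have := in_set0 x; rewrite -cT !inE xc.
  left; exists (size c); split=> //; first by case/and3P: cc.
  apply: spanning_cycle_isomorphic => // x y exy.
  (* A chord of [c] could be bypassed along [c], so it would not be a bridge and would have to be an
     edge of [c]. *)
  apply: contraT => xyc; rewrite -(negPf xyc).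
  apply: (cycle_edges_bridge e_sym e_conn card_e cc exy).
  have /and3P[_ _ cc'] := graph_cycle_del_edge cc xyc.
  exact: connect_cycle cc' _ _ (cT x) (cT y).
(* A cycle off [c] would, by uniqueness, have the same edges as [c], although its vertices avoid
   [c]. *)
right; exists c => //; split=> // c'; apply/negP=> cc'.
have /c_uniq eqE : graph_cycle e (map val c').
  move: cc' => /and3P[c3 cu ec]; rewrite /graph_cycle size_map c3.
  by rewrite (map_inj_uniq val_inj) cu (cycle_map c').
have [x xc'] : exists x, x \in c'.
  by case/and3P: cc'; case: (c') => // x p _ _ _; exists x; rewrite mem_head.
have : [set val x; next (map val c') (val x)] \in cycle_edges c.
  by rewrite -eqE; apply: imset_f; apply: map_f.
case/imsetP => z zc /setP/(_ (val x)); rewrite !inE eqxx /= => /esym xz.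
have xc : val x \in c by rewrite /=; case/orP: xz => /eqP->; rewrite ?mem_next.
by have := valP x; rewrite /= !inE xc.
Qed.
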